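(* Let $\mathcal{H}$ be the category of hypergraphs and $\mathcal{G}$ the category of graphs. The functor $\mathbf{B}:\mathcal{H}\to\mathcal{G}$ sending a hypergraph $H$ to its associated bipartite graph $B_H$ and a morphism $\varphi:H_1\to H_2$ to the induced morphism $\varphi_*:B_{H_1}\to B_{H_2}$ is faithful.
   Context: A hypergraph $H$ consists of a nonempty finite set $V(H)$ of vertices and a finite multiset $E(H)$ of nonempty subsets of $V(H)$ (edges; repeated edges are allowed and count as different elements of $E(H)$) with $\bigcup_{e\in E(H)}e=V(H)$. Graphs are finite and undirected (not required to be connected here). A morphism $\varphi:H_1\to H_2$ of hypergraphs, and likewise of graphs, is a pair of maps $\varphi_V:V(H_1)\to V(H_2)$, $\varphi_E:E(H_1)\to E(H_2)$ such that $v\in e$ implies $\varphi_V(v)\in\varphi_E(e)$. Morphisms are composed componentwise. $B_H$ is the simple bipartite graph with vertex set $V(H)\sqcup E(H)$ in which $v\in V(H)$ and $e\in E(H)$ are joined by one edge exactly when $v\in e$ (no other edges). For a morphism $\varphi:H_1\to H_2$, $\varphi_*=(f_V,f_E)$ where $f_V(a)=\varphi_V(a)$ for $a\in V(H_1)$, $f_V(a)=\varphi_E(a)$ for $a\in E(H_1)$, and $f_E$ sends the edge of $B_{H_1}$ joining $a\in V(H_1)$ and $e\in E(H_1)$ to the unique edge of $B_{H_2}$ joining $\varphi_V(a)$ and $\varphi_E(e)$. *)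

(* Defs.v *)
From mathcomp Require Import all_boot.
Set Implicit Arguments.
Unset Strict Implicit.
Unset Printing Implicit Defensive.

Record category := Category {
  obj :> Type;
  hom : obj -> obj -> Type;
  idm : forall a, hom a a;
  comp : forall a b c, hom b c -> hom a b -> hom a c;
  comp_idl : forall a b (f : hom a b), comp (idm b) f = f;
  comp_idr : forall a b (f : hom a b), comp f (idm a) = f;
  compA : forall a b c d (h : hom c d) (g : hom b c) (f : hom a b),
    comp h (comp g f) = comp (comp h g) f }.

Record functor (C D : category) := Functor {
  fobj :> C -> D;
  fmap : forall a b : C, hom a b -> hom (fobj a) (fobj b);
  fmap_id : forall a : C, fmap (idm a) = idm (fobj a);
  fmap_comp : forall (a b c : C) (g : hom b c) (f : hom a b),
    fmap (comp g f) = comp (fmap g) (fmap f) }.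

Definition faithful (C D : category) (F : functor C D) : Prop :=
  forall a b : C, injective (@fmap C D F a b).

(* Common ground of graphs and hypergraphs. Edges form a type of their own,
   so distinct edges may have the same set of vertices: the multiset of edges
   is the family [ends] indexed by [edge]. *)
Record incidence := Incidence {
  vert : finType;
  edge : finType;
  ends : edge -> {set vert} }.

Record hypergraph := Hypergraph {
  hyp_inc :> incidence;
  hyp_vert_gt0 : 0 < #|vert hyp_inc|;
  hyp_edge_neq0 : forall e : edge hyp_inc, ends e != set0;
  hyp_cover : \bigcup_(e : edge hyp_inc) ends e = [set: vert hyp_inc] }.

(* Loops (one end) and parallel edges are allowed. *)
Record graph := Graph {
  graph_inc :> incidence;
  graph_ends : forall e : edge graph_inc, 0 < #|ends e| <= 2 }.

(* The incidence condition is a boolean, so that two morphisms are equal as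
   soon as their vertex and edge maps are, without any axiom. *)
Definition is_mor (H1 H2 : incidence)
    (p : {ffun vert H1 -> vert H2} * {ffun edge H1 -> edge H2}) : bool :=
  [forall v, forall e, (v \in ends e) ==> (p.1 v \in ends (p.2 e))].

Definition mor (H1 H2 : incidence) : Type :=
  {p : {ffun vert H1 -> vert H2} * {ffun edge H1 -> edge H2} | is_mor p}.

Definition mor_vert (H1 H2 : incidence) (f : mor H1 H2) := (val f).1.
Definition mor_edge (H1 H2 : incidence) (f : mor H1 H2) := (val f).2.

Lemma is_morP (H1 H2 : incidence)
    (p : {ffun vert H1 -> vert H2} * {ffun edge H1 -> edge H2}) :
  reflect (forall v e, v \in ends e -> p.1 v \in ends (p.2 e)) (is_mor p).
Proof.
apply: (iffP forallP) => [Hp v e | Hp v]; first exact/implyP/(forallP (Hp v)).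
by apply/forallP => e; apply/implyP/Hp.
Qed.

Lemma mor_ends (H1 H2 : incidence) (f : mor H1 H2) v e :
  v \in ends e -> mor_vert f v \in ends (mor_edge f e).
Proof. exact: (is_morP _ (valP f)). Qed.

Lemma mor_eq (H1 H2 : incidence) (f g : mor H1 H2) :
  mor_vert f =1 mor_vert g -> mor_edge f =1 mor_edge g -> f = g.
Proof.
move=> /ffunP eqV /ffunP eqE; apply: val_inj.
by rewrite [LHS]surjective_pairing [RHS]surjective_pairing; congr (_, _).
Qed.

Lemma mor_id_subproof (H : incidence) :
  is_mor ([ffun v : vert H => v], [ffun e : edge H => e]).
Proof. by apply/is_morP => v e /=; rewrite !ffunE. Qed.

Definition mor_id (H : incidence) : mor H H := Sub _ (mor_id_subproof H).

Lemma mor_comp_subproof (H1 H2 H3 : incidence) (g : mor H2 H3) (f : mor H1 H2) :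
  is_mor ([ffun v => mor_vert g (mor_vert f v)],
          [ffun e => mor_edge g (mor_edge f e)]).
Proof. by apply/is_morP => v e /= ve; rewrite !ffunE; do 2!apply: mor_ends. Qed.

Definition mor_comp (H1 H2 H3 : incidence) (g : mor H2 H3) (f : mor H1 H2) :
  mor H1 H3 := Sub _ (mor_comp_subproof g f).

Lemma mor_comp_idl (H1 H2 : incidence) (f : mor H1 H2) :
  mor_comp (mor_id H2) f = f.
Proof. by apply: mor_eq => x; rewrite !ffunE. Qed.

Lemma mor_comp_idr (H1 H2 : incidence) (f : mor H1 H2) :
  mor_comp f (mor_id H1) = f.
Proof. by apply: mor_eq => x; rewrite !ffunE. Qed.

Lemma mor_compA (H1 H2 H3 H4 : incidence)
    (h : mor H3 H4) (g : mor H2 H3) (f : mor H1 H2) :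
  mor_comp h (mor_comp g f) = mor_comp (mor_comp h g) f.
Proof. by apply: mor_eq => x; rewrite !ffunE. Qed.

Definition hypergraph_cat : category :=
  @Category hypergraph (fun H1 H2 => mor H1 H2) (fun H => mor_id H)
    (fun _ _ _ g f => mor_comp g f)
    (fun _ _ f => mor_comp_idl f) (fun _ _ f => mor_comp_idr f)
    (fun _ _ _ _ h g f => mor_compA h g f).

Definition graph_cat : category :=
  @Category graph (fun G1 G2 => mor G1 G2) (fun G => mor_id G)
    (fun _ _ _ g f => mor_comp g f)
    (fun _ _ f => mor_comp_idl f) (fun _ _ f => mor_comp_idr f)
    (fun _ _ _ _ h g f => mor_compA h g f).

(* The edges of B_H are the pairs (v, e) with v \in e, and (v, e) joins the
   vertices [inl v] and [inr e]. *)
Definition bip_edge (H : hypergraph) : finType :=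
  {p : vert H * edge H | p.1 \in ends p.2}.

Definition bip_inc (H : hypergraph) : incidence :=
  @Incidence (vert H + edge H)%type (bip_edge H)
    (fun x => [set inl (val x).1; inr (val x).2]).

Lemma bip_ends (H : hypergraph) (x : edge (bip_inc H)) : 0 < #|ends x| <= 2.
Proof. by rewrite cards2. Qed.

Definition bip (H : hypergraph) : graph := Graph (@bip_ends H).

Definition star_vert (H1 H2 : hypergraph) (f : mor H1 H2)
    (a : vert H1 + edge H1) : vert H2 + edge H2 :=
  match a with inl v => inl (mor_vert f v) | inr e => inr (mor_edge f e) end.

Definition star_edge (H1 H2 : hypergraph) (f : mor H1 H2)
    (x : bip_edge H1) : bip_edge H2 :=
  exist (fun p : vert H2 * edge H2 => p.1 \in ends p.2)
    (mor_vert f (val x).1, mor_edge f (val x).2) (mor_ends f (valP x)).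

Lemma star_subproof (H1 H2 : hypergraph) (f : mor H1 H2) :
  @is_mor (bip H1) (bip H2) ([ffun a => star_vert f a], [ffun x => star_edge f x]).
Proof.
apply/is_morP => a x /=; rewrite !ffunE /= !inE.
by case/orP => /eqP->; rewrite eqxx ?orbT.
Qed.

Definition star (H1 H2 : hypergraph) (f : mor H1 H2) : mor (bip H1) (bip H2) :=
  Sub _ (star_subproof f).

Lemma star_id (H : hypergraph) : star (mor_id H) = mor_id (bip H).
Proof.
apply: mor_eq => [[v|e]|[[v e] ve]]; rewrite !ffunE /= ?ffunE //.
by apply: val_inj; rewrite /= !ffunE.
Qed.

Lemma star_comp (H1 H2 H3 : hypergraph) (g : mor H2 H3) (f : mor H1 H2) :
  star (mor_comp g f) = mor_comp (star g) (star f).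
Proof.
apply: mor_eq => [[v|e]|[[v e] ve]]; rewrite !ffunE /= ?ffunE //.
by apply: val_inj; rewrite /= !ffunE.
Qed.

Definition B : functor hypergraph_cat graph_cat :=
  @Functor hypergraph_cat graph_cat bip star star_id star_comp.

(* Main.v *)
Require Import Defs.
From mathcomp Require Import all_boot.

(** The vertices of a bipartite graph B_H are the vertices and the edges of H
    together, so the vertex map of an induced morphism already determines both
    maps of the hypergraph morphism it comes from. *)

Theorem proposition3p4 : faithful B.
Proof.
move=> H1 H2 f g eq_fg.
have eq_star a : star_vert f a = star_vert g a.
  have := congr1 (fun h : mor (bip H1) (bip H2) => mor_vert h a) eq_fg.
  by rewrite !ffunE.
apply: mor_eq => [v | e].
  by have [] := eq_star (inl v).
by have [] := eq_star (inr e).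
Qed.
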